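(* Assume $0<\frac{\mu-r}{\sigma^2}<1$. Let $\pi^*_{DKS}$ and $f^0(t)$ be the optimal liquid-regime stock fraction and the wealth-independent part of the value function in the terminal log-wealth problem with liquidity shocks given in the context. Then, as $\lambda_{01}\to0$ with all other parameters fixed, $$\pi^*_{DKS}=\frac{\mu-r}{\sigma^2}-\lambda_{01}\frac L{\sigma^2-(\mu-r)L}+O(\lambda_{01}^2),$$ and for each $t\in[0,T]$ $$f^0(t)=\Bigl(r+\frac{(\mu-r)^2}{2\sigma^2}\Bigr)(T-t)+\lambda_{01}\Bigl[\frac{(\mu-r)^2}{2\sigma^2\lambda_{10}^2}\bigl(1-e^{-\lambda_{10}(T-t)}-\lambda_{10}(T-t)\bigr)+\log\Bigl(1-\frac{(\mu-r)L}{\sigma^2}\Bigr)(T-t)\Bigr]+O(\lambda_{01}^2).$$ Consequently the efficiency loss $\mathbf\Theta^{(DKS)}(t)$, defined by $\log x+f^0(t)=\log\bigl((1-\mathbf\Theta^{(DKS)}(t))x\bigr)+\bigl(r+\frac{(\mu-r)^2}{2\sigma^2}\bigr)(T-t)$, satisfies $\mathbf\Theta^{(DKS)}(t)=\lambda_{01}\mathbf\Theta^{(DKS)}_1(t)+O(\lambda_{01}^2)$ with $$\mathbf\Theta_1^{(DKS)}(t)=\frac{(\mu-r)^2}{2\sigma^2\lambda_{10}^2}\bigl(e^{-\lambda_{10}(T-t)}+\lambda_{10}(T-t)-1\bigr)-\log\Bigl(1-\frac{(\mu-r)L}{\sigma^2}\Bigr)(T-t).$$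
   Context: Parameters: $T>0$, $\lambda_{01},\lambda_{10}>0$, $r,\mu\in\mathbb R$, $\sigma>0$, $L\in[0,1)$. In the model of Diesinger, Kraft and Seifried, an agent maximizes expected logarithm of terminal wealth at time $T$ (no consumption) in a market that switches between a liquid Black–Scholes regime (drift $\mu$, volatility $\sigma$, interest rate $r$) and an illiquid regime (no trading, stock growth rate $r$), with rates $\lambda_{01}$ (liquid to illiquid) and $\lambda_{10}$ (back), each shock costing a fraction $L$ of the stock value. The known solution is: the liquid-regime value function is $\log x+f^0(t)$, where the optimal liquid-regime stock fraction $\pi:=\pi^*_{DKS}\in[0,1]$ is defined by $$0=(\mu-r)-\sigma^2\pi-\lambda_{01}\frac L{1-L\pi},$$ and, writing $A=r+(\mu-r)\pi-\frac12\sigma^2\pi^2+\frac{\lambda_{01}}{\lambda_{10}}\bigl(r+\lambda_{10}\log(1-\pi L)\bigr)$, $$f^0(t)=\frac{\lambda_{01}}{\lambda_{01}+\lambda_{10}}\Bigl[A\,\frac{1-e^{-(\lambda_{01}+\lambda_{10})(T-t)}}{\lambda_{01}+\lambda_{10}}-\frac r{\lambda_{10}}\bigl(e^{-\lambda_{10}(T-t)}-e^{-(\lambda_{01}+\lambda_{10})(T-t)}\bigr)\Bigr]+\frac{\lambda_{10}}{\lambda_{01}+\lambda_{10}}\Bigl[\frac{\lambda_{01}r}{\lambda_{10}^2}\bigl(-1+e^{-\lambda_{10}(T-t)}\bigr)+A\,(T-t)\Bigr].$$ With $\lambda_{01}=0$ one recovers the Merton value $\log x+\bigl(r+\frac{(\mu-r)^2}{2\sigma^2}\bigr)(T-t)$.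 *)

(* Defs.v *)
From mathcomp Require Import all_boot all_order all_algebra.
From mathcomp Require Import all_classical all_reals all_analysis.
From mathcomp Require Import ring lra.

Set Implicit Arguments.
Unset Strict Implicit.
Unset Printing Implicit Defensive.

Import Order.TTheory GRing.Theory Num.Theory.
Import numFieldNormedType.Exports.

Local Open Scope classical_set_scope.
Local Open Scope ring_scope.

(* Log-utility maximization of terminal wealth in the market of Diesinger, Kraft
   and Seifried: a liquid Black-Scholes regime (interest rate r, drift mu,
   volatility sigma) and an illiquid one, with switching rates lam01 (liquid to
   illiquid) and lam10 (back), and a relative loss L of the stock value at each
   liquidity shock. The solution of the control problem is taken in its known
   closed form. *)

Definition is_pi_DKS (R : realType) (r mu sigma L lam01 p : R) : Prop :=
  0 <= p <= 1 /\
  0 = (mu - r) - sigma ^+ 2 * p - lam01 * (L / (1 - L * p)).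

Lemma is_pi_DKS_unique (R : realType) (r mu sigma L lam01 p q : R) :
  0 < sigma -> 0 <= L < 1 -> 0 <= lam01 ->
  is_pi_DKS r mu sigma L lam01 p -> is_pi_DKS r mu sigma L lam01 q -> p = q.
Proof.
move=> s0 L01 l0 [p01 ep] [q01 eq].
wlog pq : p q p01 ep q01 eq / p <= q.
  by move=> H; case: (leP p q) => [|/ltW] /H; [apply|move/(_ q01 eq p01 ep)].
have Dp : 0 < 1 - L * p by nra.
have Dq : 0 < 1 - L * q by nra.
have h : L / (1 - L * p) <= L / (1 - L * q).
  rewrite ler_wpM2l //; first lra.
  by rewrite lef_pV2 ?posrE//; nra.
have s2 : 0 < sigma ^+ 2 by rewrite exprn_gt0.
have h2 : lam01 * (L / (1 - L * p)) <= lam01 * (L / (1 - L * q)).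
  exact: ler_wpM2l.
by nra.
Qed.

(* If (mu - r) / sigma ^+ 2 lies in ]0, 1[, the (unique) solution in [0, 1]
   exists (for lam01 >= 0) exactly when lam01 * L <= mu - r, hence for all small lam01; the value
   0 returned otherwise is irrelevant as lam01 tends to 0. *)
Definition pi_DKS (R : realType) (r mu sigma L lam01 : R) : R :=
  xget 0 [set p | is_pi_DKS r mu sigma L lam01 p].

Definition A_DKS (R : realType) (lam10 r mu sigma L lam01 : R) : R :=
  let p := pi_DKS r mu sigma L lam01 in
  r + (mu - r) * p - 2^-1 * sigma ^+ 2 * p ^+ 2
    + lam01 / lam10 * (r + lam10 * ln (1 - p * L)).

Definition f0_DKS (R : realType) (T lam10 r mu sigma L lam01 t : R) : R :=
  let A := A_DKS lam10 r mu sigma L lam01 in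
  lam01 / (lam01 + lam10) *
    (A * ((1 - expR (- (lam01 + lam10) * (T - t))) / (lam01 + lam10))
     - r / lam10 * (expR (- lam10 * (T - t))
                    - expR (- (lam01 + lam10) * (T - t))))
  + lam10 / (lam01 + lam10) *
    (lam01 * r / lam10 ^+ 2 * (-1 + expR (- lam10 * (T - t))) + A * (T - t)).

Definition value_DKS (R : realType) (T lam10 r mu sigma L lam01 x t : R) : R :=
  ln x + f0_DKS T lam10 r mu sigma L lam01 t.

Definition value_Merton (R : realType) (T r mu sigma x t : R) : R :=
  ln x + (r + (mu - r) ^+ 2 / (2 * sigma ^+ 2)) * (T - t).

(* The condition theta < 1 makes (1 - theta) * x a legitimate argument of the
   logarithm ([ln] is 0 on nonpositive numbers). *)
Definition is_efficiency_loss_DKS (R : realType)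
    (T lam10 r mu sigma L lam01 t theta : R) : Prop :=
  theta < 1 /\
  forall x : R, 0 < x ->
    value_DKS T lam10 r mu sigma L lam01 x t =
    value_Merton T r mu sigma ((1 - theta) * x) t.

Lemma is_efficiency_loss_DKS_ex_unique (R : realType)
    (T lam10 r mu sigma L lam01 t : R) :
  exists! theta, is_efficiency_loss_DKS T lam10 r mu sigma L lam01 t theta.
Proof.
set f := f0_DKS T lam10 r mu sigma L lam01 t.
set m := (r + (mu - r) ^+ 2 / (2 * sigma ^+ 2)) * (T - t).
exists (1 - expR (f - m)); split.
  split=> [|x x0]; first by rewrite ltrBlDr ltrDl expR_gt0.
  rewrite /value_DKS /value_Merton -/f -/m subKr lnM ?posrE ?expR_gt0// expRK.
  ring.
move=> th [th1 /(_ 1 ltr01)]; rewrite /value_DKS /value_Merton -/f -/m mulr1 ln1.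
rewrite add0r => ->; rewrite addrK lnK ?posrE ?subr_gt0//; ring.
Qed.

Definition efficiency_loss_DKS (R : realType)
    (T lam10 r mu sigma L lam01 t : R) : R :=
  xget 0 [set theta | is_efficiency_loss_DKS T lam10 r mu sigma L lam01 t theta].

(* Main.v *)
Require Import Defs.
From mathcomp Require Import all_boot all_order all_algebra.
From mathcomp Require Import all_classical all_reals all_analysis.
From mathcomp Require Import ring lra.

Set Implicit Arguments.
Unset Strict Implicit.
Unset Printing Implicit Defensive.

Import Order.TTheory GRing.Theory Num.Theory.
Import numFieldNormedType.Exports.

Local Open Scope classical_set_scope.
Local Open Scope ring_scope.

(* First-order expansions at 0+ with a quadratic error are stable under sums,
   products, inverses, exp and ln, so everything follows mechanically from the
   expansion of the stock fraction. For the latter, the defining equation reads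
   p = p0 - lam01 * L / (sigma ^+ 2 * (1 - L * p)) with p0 = (mu - r) / sigma ^+ 2;
   substituting it into itself gives a closed form for the error, of order
   lam01 ^+ 2 because 1 - L * p >= 1 - L > 0. The first-order term of f0 does not
   see that of p, since p0 maximizes (mu - r) * p - sigma ^+ 2 * p ^+ 2 / 2. The
   efficiency loss is 1 - exp (f0 - Merton value). *)

(** * Calculus of first-order expansions at 0+ *)

Definition jet1 (R : realType) (f : R -> R) (a b : R) : Prop :=
  exists2 K : R, 0 <= K &
    \forall l \near 0^'+, `|f l - (a + b * l)| <= K * l ^+ 2.

Lemma jet1_eqO (R : realType) (f g : R -> R) (a b : R) :
  jet1 f a b -> (forall l, g l = a + b * l) ->
  f = g +O_ (0^'+) (fun l : R => l ^+ 2).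
Proof.
move=> [K K0 fK] gE; apply/eqaddOP.
(* [eqaddOP] asks for the bound for all large [k]; every [k] above [K] will do. *)
near=> k; near=> l.
rewrite [X in `|X|](_ : _ = f l - (a + b * l)); last by rewrite -gE.
rewrite (@ger0_norm _ (l ^+ 2)) ?sqr_ge0//.
apply: (@le_trans _ _ (K * l ^+ 2)); first by near: l.
rewrite ler_wpM2r ?sqr_ge0//.
Unshelve. all: by end_near. Qed.

Lemma jet1_eq (R : realType) (f g : R -> R) (a b a' b' : R) :
  jet1 f a b -> (forall l, g l = f l) -> a' = a -> b' = b -> jet1 g a' b'.
Proof. by move=> jf /funext -> -> ->. Qed.

Lemma jet1_cst (R : realType) (c : R) : jet1 (fun=> c) c 0.
Proof.
exists 0 => //; near=> l.
by rewrite mul0r addr0 subrr normr0 mul0r.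
Unshelve. all: by end_near. Qed.

Lemma jet1_id (R : realType) : jet1 (@id R) 0 1.
Proof.
exists 0 => //; near=> l.
by rewrite mul1r add0r subrr normr0 mul0r.
Unshelve. all: by end_near. Qed.

Lemma jet1D (R : realType) (f g : R -> R) (a b a' b' : R) :
  jet1 f a b -> jet1 g a' b' ->
  jet1 (fun l => f l + g l) (a + a') (b + b').
Proof.
move=> [K K0 fK] [M M0 gM]; exists (K + M); first exact: addr_ge0.
apply: filterS2 fK gM => l hf hg.
rewrite (_ : _ - _ = (f l - (a + b * l)) + (g l - (a' + b' * l))); last ring.
by rewrite mulrDl (le_trans (ler_normD _ _))// lerD.
Qed.

Lemma jet1M (R : realType) (f g : R -> R) (a b a' b' : R) :
  jet1 f a b -> jet1 g a' b' ->
  jet1 (fun l => f l * g l) (a * a') (a * b' + b * a').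
Proof.
move=> [K K0 fK] [M M0 gM].
(* The three summands bound, for [l < 1], the three pieces of the error: (error of [f]) times [g],
   the affine part of [f] times (error of [g]), and the leftover [b * b' * l ^+ 2]. *)
exists (K * (`|a'| + `|b'| + M) + (`|a| + `|b|) * M + `|b| * `|b'|).
  by rewrite !(addr_ge0, mulr_ge0).
have l0' := nbhs_right_gt (0 : R).
have l1' := nbhs_right_lt (@ltr01 R).
near=> l.
have l0 : 0 < l by near: l.
have l1 : l < 1 by near: l.
have hf : `|f l - (a + b * l)| <= K * l ^+ 2 by near: l.
have hg : `|g l - (a' + b' * l)| <= M * l ^+ 2 by near: l.
have aff (u v : R) : `|u + v * l| <= `|u| + `|v|.
  rewrite (le_trans (ler_normD _ _))// lerD2l normrM (gtr0_norm l0).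
  by rewrite ler_piMr// ltW.
have hg' : `|g l| <= `|a'| + `|b'| + M.
  rewrite -(subrK (a' + b' * l) (g l)) addrC (le_trans (ler_normD _ _))//.
  rewrite lerD//; apply: (le_trans hg).
  by rewrite ler_piMr// expr_le1// ltW.
rewrite (_ : _ - _ = (f l - (a + b * l)) * g l
  + (a + b * l) * (g l - (a' + b' * l)) + b * b' * l ^+ 2); last ring.
rewrite [leRHS]mulrDl (le_trans (ler_normD _ _))// lerD//; last first.
  by rewrite [leLHS]normrM (@normrM _ b) (@ger0_norm _ (l ^+ 2)) ?sqr_ge0.
rewrite [leRHS]mulrDl (le_trans (ler_normD _ _))// lerD// normrM.
  by rewrite mulrAC ler_pM.
by rewrite -mulrA ler_pM.
Unshelve. all: by end_near. Qed.

(** The Taylor bound of [phi] is used at [h = f l - a], which is at most [(|b| + M) * l]: it stays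
    within the radius [e] for small [l], and its square is of order [l ^+ 2]. *)
Lemma jet1_comp (R : realType) (phi f : R -> R) (a b c K e : R) :
  0 <= K -> 0 < e ->
  (forall h, `|h| <= e -> `|phi (a + h) - (phi a + c * h)| <= K * h ^+ 2) ->
  jet1 f a b -> jet1 (fun l => phi (f l)) (phi a) (c * b).
Proof.
move=> K0 e0 phiK [M M0 fM].
(* The [+ 1] keeps the divisor of [e] positive even if [b] and [M] vanish. *)
have bM : 0 < `|b| + M + 1 by rewrite ltr_wpDl// addr_ge0.
exists (K * (`|b| + M) ^+ 2 + `|c| * M).
  by rewrite addr_ge0// mulr_ge0// ?sqr_ge0.
have l0' := nbhs_right_gt (0 : R).
have l1' := nbhs_right_lt (@ltr01 R).
have le' := nbhs_right_lt (divr_gt0 e0 bM).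
near=> l.
have l0 : 0 < l by near: l.
have l1 : l < 1 by near: l.
have le : l < e / (`|b| + M + 1) by near: l.
have hf : `|f l - (a + b * l)| <= M * l ^+ 2 by near: l.
have hd : `|f l - a| <= (`|b| + M) * l.
  rewrite (_ : _ - _ = b * l + (f l - (a + b * l))); last ring.
  rewrite (le_trans (ler_normD _ _))// mulrDl lerD//.
    by rewrite normrM (gtr0_norm l0).
  rewrite (le_trans hf)// ler_wpM2l// expr2 ler_piMr// ltW//.
have /phiK : `|f l - a| <= e.
  rewrite (le_trans hd)//; move: le; rewrite ltr_pdivlMr// => {}le.
  by apply: ltW; apply: le_lt_trans le; rewrite mulrC ler_pM2l// lerDl.
rewrite [a + _]addrC subrK => h.
rewrite (_ : _ - _ = (phi (f l) - (phi a + c * (f l - a)))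
  + c * (f l - (a + b * l))); last ring.
rewrite (le_trans (ler_normD _ _))// mulrDl lerD//.
  rewrite (le_trans h)// -mulrA ler_wpM2l// -exprMn -real_normK ?num_real//.
  by rewrite ler_sqr ?nnegrE// mulr_ge0 ?addr_ge0// ltW.
by rewrite normrM -mulrA ler_wpM2l.
Unshelve. all: by end_near. Qed.

(** The Taylor error of the inverse is exactly [h ^+ 2 / (a ^+ 2 * (a + h))], and
    [a + h >= a / 2]. *)
Lemma jet1_inv (R : realType) (f : R -> R) (a b : R) :
  0 < a -> jet1 f a b -> jet1 (fun l => (f l)^-1) a^-1 (- a ^- 2 * b).
Proof.
move=> a0; apply: (@jet1_comp _ (@GRing.inv R) _ _ _ _ (2 / a ^+ 3) (a / 2)).
- by rewrite divr_ge0 ?exprn_ge0 ?ltW.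
- exact: divr_gt0.
move=> h /ler_normlP[h1 h2].
have ah : a / 2 <= a + h by lra.
have ah0 : 0 < a + h by lra.
rewrite (_ : _ - _ = h ^+ 2 * (a ^- 2 / (a + h))); last first.
  by field; rewrite !gt_eqF.
rewrite ger0_norm; last first.
  by rewrite mulr_ge0 ?sqr_ge0// divr_ge0 ?invr_ge0 ?exprn_ge0 ?ltW.
rewrite mulrC ler_wpM2r ?sqr_ge0// (_ : 2 / a ^+ 3 = a ^- 2 / (a / 2)).
  by rewrite ler_wpM2l ?invr_ge0 ?sqr_ge0// lef_pV2 ?posrE// divr_gt0.
by field; rewrite gt_eqF.
Qed.

(** Squeeze [expR h] between [1 + h] and [(1 - h)^-1], the upper bound being the lower one at [- h];
    for [|h| <= 1/2] the gap [h ^+ 2 / (1 - h)] is at most [2 * h ^+ 2]. *)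
Lemma jet1_expR (R : realType) (f : R -> R) (a b : R) :
  jet1 f a b -> jet1 (fun l => expR (f l)) (expR a) (expR a * b).
Proof.
apply: (@jet1_comp _ expR _ _ _ _ (2 * expR a) 2^-1).
- by rewrite mulr_ge0 ?expR_ge0.
- by rewrite invr_gt0.
move=> h /ler_normlP[h1 h2].
rewrite expRD (_ : _ - _ = expR a * (expR h - 1 - h)); last ring.
rewrite normrM (gtr0_norm (expR_gt0 a)) [2 * _]mulrC -mulrA.
rewrite ler_wpM2l ?expR_ge0//.
have lo := expR_ge1Dx h.
have hi : expR h <= (1 - h)^-1.
  rewrite -[expR h]invrK -expRN lef_pV2 ?posrE ?expR_gt0//; last lra.
  exact: expR_ge1Dx.
rewrite ger0_norm; last lra.
apply: (@le_trans _ _ ((1 - h)^-1 - 1 - h)); first lra.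
rewrite (_ : _ - h = h ^+ 2 / (1 - h)); last by field; lra.
rewrite mulrC ler_wpM2r ?sqr_ge0// -[leRHS]invrK lef_pV2 ?posrE; lra.
Qed.

(** After scaling to [x = h / a], squeeze [ln (1 + x)] between [x / (1 + x)] and [x]; the lower
    bound is the upper one applied to the inverse of [1 + x]. *)
Lemma jet1_ln (R : realType) (f : R -> R) (a b : R) :
  0 < a -> jet1 f a b -> jet1 (fun l => ln (f l)) (ln a) (a^-1 * b).
Proof.
move=> a0; apply: (@jet1_comp _ (@ln R) _ _ _ _ (2 / a ^+ 2) (a / 2)).
- by rewrite divr_ge0 ?exprn_ge0 ?ltW.
- exact: divr_gt0.
move=> h /ler_normlP[h1 h2].
have ah0 : 0 < a + h by lra.
pose x := h / a.
have x12 : - 2^-1 <= x <= 2^-1.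
  by apply/andP; split; rewrite ?ler_pdivlMr ?ler_pdivrMr//; lra.
have hx : h = x * a by rewrite /x mulfVK// gt_eqF.
rewrite (_ : a + h = a * (1 + x)); last by rewrite hx; ring.
have x1 : 0 < 1 + x by lra.
rewrite lnM ?posrE// (_ : _ - _ = ln (1 + x) - x); last first.
  by rewrite /x; ring.
rewrite (_ : 2 / a ^+ 2 * h ^+ 2 = 2 * x ^+ 2); last first.
  by rewrite /x; field; rewrite gt_eqF.
have hi : ln (1 + x) <= x by apply: le_ln1Dx; lra.
have lo : x / (1 + x) <= ln (1 + x).
  rewrite -lerN2 -lnV ?posrE//.
  have {1}-> : (1 + x)^-1 = 1 + - (x / (1 + x)) by field; rewrite gt_eqF.
  by apply: le_ln1Dx; rewrite ltrN2 ltr_pdivrMr//; lra.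
have e1 : x / (1 + x) = x - x ^+ 2 / (1 + x) by field; rewrite gt_eqF.
have e2 : x ^+ 2 / (1 + x) <= 2 * x ^+ 2.
  rewrite mulrC ler_wpM2r ?sqr_ge0// -[leRHS]invrK lef_pV2 ?posrE//; lra.
have := sqr_ge0 x.
by move=> ?; apply/ler_normlP; split; lra.
Qed.

(** * Existence and expansion of the stock fraction *)

(** Intermediate values on [0, 1]: the cleared equation is [l * L - (mu - r) <= 0] at 0 and [l * L +
    (sigma ^+ 2 - (mu - r)) * (1 - L) >= 0] at 1. *)
Lemma is_pi_DKS_exists (R : realType) (r mu sigma L l : R) :
  0 < sigma -> 0 <= L < 1 -> 0 < l -> l * L <= mu - r ->
  (mu - r) / sigma ^+ 2 < 1 ->
  exists p, is_pi_DKS r mu sigma L l p.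
Proof.
move=> s0 L01 l0 lL; rewrite ltr_pdivrMr ?exprn_gt0// mul1r => m1.
(* The equation of p, cleared of its denominator. *)
pose P : {poly R} :=
  (l * L)%:P - ((mu - r)%:P - (sigma ^+ 2) *: 'X) * (1 - L *: 'X).
have PE x : P.[x] = l * L - (mu - r - sigma ^+ 2 * x) * (1 - L * x).
  by rewrite /P !hornerE.
have [||p p01 /rootP] := @poly_ivt R P 0 1 => //.
  rewrite !PE; nra.
rewrite PE => e; exists p; split => //.
have q0 : 1 - L * p != 0 by rewrite gt_eqF//; nra.
move/subr0_eq: e; rewrite mulrA => ->.
by rewrite mulfK// subrr.
Qed.

Lemma jet1_pi_DKS (R : realType) (r mu sigma L : R) :
  0 < sigma -> 0 <= L < 1 -> 0 < (mu - r) / sigma ^+ 2 < 1 ->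
  jet1 (pi_DKS r mu sigma L) ((mu - r) / sigma ^+ 2)
    (- (L / (sigma ^+ 2 - (mu - r) * L))).
Proof.
move=> s0 L01 /andP[m0 m1].
have s2 : 0 < sigma ^+ 2 by rewrite exprn_gt0.
have m0' : 0 < mu - r by move: m0; rewrite pmulr_lgt0 ?invr_gt0.
have m1' : mu - r < sigma ^+ 2 by move: m1; rewrite ltr_pdivrMr// mul1r.
have L1 : 0 < 1 - L by lra.
have sm : 0 < sigma ^+ 2 - (mu - r) * L.
  by have := mulr_gt0 m0' L1; lra.
have C0 : 0 <= L ^+ 3 / (sigma ^+ 2 * (sigma ^+ 2 - (mu - r) * L)).
  by case/andP: L01 => L0 _; rewrite divr_ge0 ?exprn_ge0// ltW// mulr_gt0.
exists (L ^+ 3 / (sigma ^+ 2 * (sigma ^+ 2 - (mu - r) * L)) / (1 - L) ^+ 2).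
  by rewrite divr_ge0// sqr_ge0.
have l0' := nbhs_right_gt (0 : R).
(* With [l < mu - r] a solution exists, so [xget] returns it and not its default 0. *)
have lm' := nbhs_right_lt m0'.
near=> l.
have l0 : 0 < l by near: l.
have lm : l < mu - r by near: l.
have [p01 ep] : is_pi_DKS r mu sigma L l (pi_DKS r mu sigma L l).
  by apply: (xgetPex 0); apply: is_pi_DKS_exists => //; nra.
set p := pi_DKS r mu sigma L l in p01 ep *.
have q0 : 1 - L <= 1 - L * p by nra.
have q0' : 0 < 1 - L * p by lra.
have pE : p = (mu - r) / sigma ^+ 2 - l * L / (sigma ^+ 2 * (1 - L * p)).
  apply: (mulfI (lt0r_neq0 s2)).
  rewrite -[LHS]addr0 ep; field.
  by rewrite !gt_eqF.
(* [w] is the gap between the Merton fraction and [p]. Expressing [1 - L * p] through [w] makes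
   [l * L] quadratic in [w], so that the error of the expansion is an exact multiple of [w ^+ 2]. *)
set w := l * L / _ in pE.
have lLE : l * L = w * (sigma ^+ 2 - (mu - r) * L + sigma ^+ 2 * L * w).
  have {1}-> : l * L = w * (sigma ^+ 2 * (1 - L * p)).
    by rewrite /w mulfVK// gt_eqF ?mulr_gt0.
  by rewrite pE; field; rewrite gt_eqF.
rewrite (_ : _ - _ = L ^+ 3 / (sigma ^+ 2 * (sigma ^+ 2 - (mu - r) * L)) /
    (1 - L * p) ^+ 2 * l ^+ 2).
  rewrite ger0_norm; last by rewrite mulr_ge0 ?sqr_ge0// divr_ge0 ?sqr_ge0.
  rewrite ler_wpM2r ?sqr_ge0// ler_wpM2l// lef_pV2 ?posrE ?exprn_gt0//.
  by rewrite ler_sqr ?nnegrE// ltW.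
transitivity (L * sigma ^+ 2 * w ^+ 2 / (sigma ^+ 2 - (mu - r) * L)).
  transitivity (l * L / (sigma ^+ 2 - (mu - r) * L) - w).
    by rewrite [X in X - _]pE; field; rewrite !gt_eqF.
  by rewrite lLE; field; rewrite gt_eqF.
by rewrite /w; field; rewrite !gt_eqF.
Unshelve. all: by end_near. Qed.

(** * Expansion of the value function *)

Lemma jet1_f0_DKS (R : realType) (T lam10 r mu sigma L t : R) :
  0 < lam10 -> 0 < sigma -> 0 <= L < 1 -> 0 < (mu - r) / sigma ^+ 2 < 1 ->
  jet1 (fun l => f0_DKS T lam10 r mu sigma L l t)
    ((r + (mu - r) ^+ 2 / (2 * sigma ^+ 2)) * (T - t))
    ((mu - r) ^+ 2 / (2 * sigma ^+ 2 * lam10 ^+ 2)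
        * (1 - expR (- lam10 * (T - t)) - lam10 * (T - t))
      + ln (1 - (mu - r) * L / sigma ^+ 2) * (T - t)).
Proof.
move=> k0 s0 L01 m01; have jp := jet1_pi_DKS s0 L01 m01.
have s2 : 0 < sigma ^+ 2 by rewrite exprn_gt0.
move/andP: m01 => [m0 m1].
have m0' : 0 < mu - r by move: m0; rewrite pmulr_lgt0 ?invr_gt0.
have m1' : mu - r < sigma ^+ 2 by move: m1; rewrite ltr_pdivrMr// mul1r.
have L1 : 0 < 1 - L by lra.
have sm : 0 < sigma ^+ 2 - (mu - r) * L.
  by have := mulr_gt0 m0' L1; lra.
set p := pi_DKS r mu sigma L in jp.
have jc := @jet1_cst R.
have q0E : 1 + (mu - r) / sigma ^+ 2 * - L = 1 - (mu - r) * L / sigma ^+ 2.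
  by field; rewrite gt_eqF.
have q0 : 0 < 1 + (mu - r) / sigma ^+ 2 * - L.
  by rewrite q0E subr_gt0 ltr_pdivrMr// mul1r -subr_gt0.
have jln := jet1_ln q0 (jet1D (jc 1) (jet1M jp (jc (- L)))).
have jl := @jet1_id R.
have jA : jet1 (A_DKS lam10 r mu sigma L)
    (r + (mu - r) ^+ 2 / (2 * sigma ^+ 2))
    (r / lam10 + ln (1 - (mu - r) * L / sigma ^+ 2)).
  have := jet1D (jet1D (jet1D (jc r) (jet1M (jc (mu - r)) jp))
     (jet1M (jc (- (2^-1 * sigma ^+ 2))) (jet1M jp jp)))
     (jet1M (jet1M jl (jc lam10^-1)) (jet1D (jc r) (jet1M (jc lam10) jln))).
  move=> /jet1_eq; apply.
  - by move=> l; rewrite /A_DKS -/p mulrN !mulNr expr2.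
  - by field; rewrite !gt_eqF.
  - rewrite q0E; field.
    by rewrite !gt_eqF.
(* At [l = 0] the two exponentials of [f0_DKS] coincide; [field] must see them as the same atom. *)
have eE : -1 * (0 + lam10) * (T - t) = - lam10 * (T - t) by ring.
have jS := jet1D jl (jc lam10).
have jSV := jet1_inv _ jS; rewrite add0r in jSV; have {}jSV := jSV k0.
have jE := jet1_expR (jet1M (jet1M (jc (-1)) jS) (jc (T - t))).
(* The term follows the syntax tree of [f0_DKS], each difference being a sum with a negated
   factor. *)
have := jet1D
  (jet1M (jet1M jl jSV)
    (jet1D (jet1M jA (jet1M (jet1D (jc 1) (jet1M (jc (-1)) jE)) jSV))
       (jet1M (jc (- (r / lam10)))
          (jet1D (jc (expR (- lam10 * (T - t)))) (jet1M (jc (-1)) jE)))))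
  (jet1M (jet1M (jc lam10) jSV)
    (jet1D (jet1M (jet1M jl (jc (r / lam10 ^+ 2)))
                  (jc (-1 + expR (- lam10 * (T - t)))))
           (jet1M jA (jc (T - t))))).
move=> /jet1_eq; apply.
- by move=> l; rewrite /f0_DKS !mulN1r !mulNr !mulrA.
- by rewrite eE; field; rewrite !gt_eqF.
- by rewrite eE; field; rewrite !gt_eqF.
Qed.

(** * Efficiency loss and conclusion *)

Lemma efficiency_loss_DKSE (R : realType) (T lam10 r mu sigma L l t : R) :
  efficiency_loss_DKS T lam10 r mu sigma L l t =
  1 - expR (f0_DKS T lam10 r mu sigma L l t
            - (r + (mu - r) ^+ 2 / (2 * sigma ^+ 2)) * (T - t)).
Proof.
have [th [Pth _]] := is_efficiency_loss_DKS_ex_unique T lam10 r mu sigma L l t.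
have [] : is_efficiency_loss_DKS T lam10 r mu sigma L l t
    (efficiency_loss_DKS T lam10 r mu sigma L l t).
  by apply: (xgetPex 0); exists th.
move=> th1 /(_ 1 ltr01); rewrite /value_DKS /value_Merton mulr1 ln1 add0r => ->.
by rewrite addrK lnK ?posrE ?subr_gt0// subKr.
Qed.

Theorem mainTheorem10 (R : realType) (T lam10 r mu sigma L : R)
    (T_gt0 : 0 < T) (lam10_gt0 : 0 < lam10) (sigma_gt0 : 0 < sigma)
    (L_range : 0 <= L < 1)
    (merton_range : 0 < (mu - r) / sigma ^+ 2 < 1) :
  [/\ (fun lam01 : R => pi_DKS r mu sigma L lam01) =
        (fun lam01 : R => (mu - r) / sigma ^+ 2
           - lam01 * (L / (sigma ^+ 2 - (mu - r) * L)))
        +O_ (0^'+) (fun lam01 : R => lam01 ^+ 2),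
      forall t : R, 0 <= t <= T ->
        (fun lam01 : R => f0_DKS T lam10 r mu sigma L lam01 t) =
        (fun lam01 : R => (r + (mu - r) ^+ 2 / (2 * sigma ^+ 2)) * (T - t)
           + lam01 * ((mu - r) ^+ 2 / (2 * sigma ^+ 2 * lam10 ^+ 2)
                        * (1 - expR (- lam10 * (T - t)) - lam10 * (T - t))
                      + ln (1 - (mu - r) * L / sigma ^+ 2) * (T - t)))
        +O_ (0^'+) (fun lam01 : R => lam01 ^+ 2)
    & forall t : R, 0 <= t <= T ->
        (fun lam01 : R => efficiency_loss_DKS T lam10 r mu sigma L lam01 t) =
        (fun lam01 : R => lam01 *
           ((mu - r) ^+ 2 / (2 * sigma ^+ 2 * lam10 ^+ 2)
              * (expR (- lam10 * (T - t)) + lam10 * (T - t) - 1)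
            - ln (1 - (mu - r) * L / sigma ^+ 2) * (T - t)))
        +O_ (0^'+) (fun lam01 : R => lam01 ^+ 2)].
Proof.
have jf t := jet1_f0_DKS T t lam10_gt0 sigma_gt0 L_range merton_range.
split=> [|t _|t _].
- apply: jet1_eqO (jet1_pi_DKS sigma_gt0 L_range merton_range) _ => l.
  by rewrite mulNr [l * _]mulrC.
- by apply: jet1_eqO (jf t) _ => l; rewrite [l * _]mulrC.
- set m := (r + (mu - r) ^+ 2 / (2 * sigma ^+ 2)) * (T - t).
  have jc := @jet1_cst R.
  (* Subtracting the Merton term [m] makes the exponent vanish at order 0, so the first-order
     coefficient of the loss is minus that of [f0_DKS]. *)
  have jE := jet1D (jc 1) (jet1M (jc (-1)) (jet1_expR (jet1D (jf t) (jc (- m))))).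
  apply: (jet1_eqO (jet1_eq jE _ erefl erefl)) => l.
  + by rewrite efficiency_loss_DKSE -/m mulN1r.
  + by rewrite subrr expR0; ring.
Qed.
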